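(* For every instance of the shared processor scheduling problem with multiprocessor jobs (as defined in the context), there exists an optimal schedule (one maximizing the total weighted overlap among all feasible schedules) that is synchronized.
   Context: An instance consists of a set $\mathcal{J}$ of $n$ jobs, each job $j$ having a processing time $p_j\ge 0$ and a weight $w_j\ge 0$, and $m\ge 1$ shared processors $\mathcal{M}_1,\dots,\mathcal{M}_m$ with costs $c_1\le c_2\le\cdots\le c_m$. Each job $j$ also has its own private processor $\mathcal{P}_j$ that only $j$ can use. A schedule $\mathcal{S}$ selects, for each job $j$: (i) for each shared processor $\mathcal{M}_i$, a (possibly empty) finite collection of pairwise disjoint open time intervals (the pieces of $j$ on $\mathcal{M}_i$) in which $j$ is executed on $\mathcal{M}_i$; (ii) a single interval $(0,C_j)$ in which $j$ executes on $\mathcal{P}_j$. The schedule is feasible if: for each $j$, $C_j$ plus the total length of all pieces of $j$ on all shared processors equals $p_j$; for each shared processor, the pieces of different jobs on it are pairwise disjoint (pieces of the same job on different shared processors may overlap in time); and every piece of $j$ on any shared processor is contained in $(0,C_j)$. For a feasible schedule, the total overlap $o(j,\mathcal{M}_i)$ of $j$ on $\mathcal{M}_i$ is the total length of time during which $j$ executes simultaneously on $\mathcal{P}_j$ and on $\mathcal{M}_i$ (here, the total length of the pieces of $j$ on $\mathcal{M}_i$), and the total weighted overlap is $\Sigma(\mathcal{S})=\sum_{i=1}^m\sum_{j\in\mathcal{J}} o(j,\mathcal{M}_i)(w_j-c_i)$. A schedule is optimal if it is feasible and maximizes $\Sigma$. A feasible schedule is synchronized if there is a subset of jobs $\{j_1,\dots,j_k\}\subseteq\mathcal{J}$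 such that every job $j\notin\{j_1,\dots,j_k\}$ executes only on its private processor in $(0,p_j)$, and there exist integers $m\ge m_1\ge m_2\ge\cdots\ge m_k\ge 1$ and times $0=t_0\le t_1\le\cdots\le t_k$ such that, for each $i\in\{1,\dots,k\}$, job $j_i$ executes (as a single piece) exactly in the interval $(t_{i-1},t_i)$ on each shared processor $\mathcal{M}_l$ with $l\in\{1,\dots,m_i\}$, on no other shared processor, and in $(0,t_i)$ on its private processor $\mathcal{P}_{j_i}$. *)

(* Defs.v *)
From mathcomp Require Export all_boot all_order all_algebra.
From mathcomp Require Export all_classical all_reals all_analysis.

Set Implicit Arguments.
Unset Strict Implicit.
Unset Printing Implicit Defensive.

Import Order.TTheory GRing.Theory Num.Theory.
Local Open Scope classical_set_scope.
Local Open Scope ring_scope.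

(* The pair [(a, b)] encodes the open interval from [a] to [b]; feasibility
   demands [a <= b], so that [a = b] encodes the empty interval, which is
   needed because synchronized schedules only require t_{i-1} <= t_i. *)
Definition piece_time (R : realType) (I : R * R) : set R := `]I.1, I.2[.

Definition piece_length (R : realType) (I : R * R) : R := I.2 - I.1.

(* Shared processors are numbered from 0: the index [i : 'I_m] stands for
   M_{i+1}.  [completion S j] is the right end C_j of the execution interval
   of [j] on its private processor. *)
Record schedule (R : realType) (J : finType) (m : nat) := Schedule {
  pieces : J -> 'I_m -> seq (R * R);
  completion : J -> R
}.

Definition shared_time (R : realType) (J : finType) (m : nat)
    (S : schedule R J m) (j : J) (i : 'I_m) : set R :=
  \bigcup_(I in [set` pieces S j i]) piece_time I.

Definition private_time (R : realType) (J : finType) (m : nat)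
    (S : schedule R J m) (j : J) : set R :=
  `]0, completion S j[.

Record feasible (R : realType) (J : finType) (m : nat) (p : J -> R)
    (S : schedule R J m) : Prop := Feasible {
  feasible_completion_ge0 : forall j, 0 <= completion S j;
  feasible_piece : forall j i I, I \in pieces S j i -> I.1 <= I.2;
  feasible_same_job : forall j i,
    trivIset `I_(size (pieces S j i))
      (fun k => piece_time (nth (0, 0) (pieces S j i) k));
  feasible_processing : forall j,
    completion S j + \sum_(i < m) \sum_(I <- pieces S j i) piece_length I
      = p j;
  feasible_distinct_jobs : forall i, trivIset [set: J] (shared_time S ^~ i);
  feasible_in_private : forall j i I,
    I \in pieces S j i -> piece_time I `<=` private_time S j
}.

Definition overlap (R : realType) (J : finType) (m : nat)
    (S : schedule R J m) (j : J) (i : 'I_m) : R :=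
  fine (lebesgue_measure (shared_time S j i `&` private_time S j)).

Definition total_weighted_overlap (R : realType) (J : finType) (m : nat)
    (w : J -> R) (c : 'I_m -> R) (S : schedule R J m) : R :=
  \sum_(i < m) \sum_(j : J) overlap S j i * (w j - c i).

Definition optimal (R : realType) (J : finType) (m : nat) (p w : J -> R)
    (c : 'I_m -> R) (S : schedule R J m) : Prop :=
  feasible p S /\
  forall S' : schedule R J m, feasible p S' ->
    total_weighted_overlap w c S' <= total_weighted_overlap w c S.

(* The chosen jobs j_1, ..., j_k are [job 0], ..., [job (k - 1)], and
   [procs i] is m_{i+1}, so [job i] runs from t_i to t_{i+1}, on the shared
   processors of zero-based index less than [procs i].  Only the values
   t_0, ..., t_k of [t] matter. *)
Definition synchronized (R : realType) (J : finType) (m : nat) (p : J -> R)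
    (S : schedule R J m) : Prop :=
  feasible p S /\
  exists (k : nat) (job : 'I_k -> J) (procs : 'I_k -> nat) (t : nat -> R),
  [/\ injective job,
      (forall i, (1 <= procs i <= m)%N) /\
      (forall i i' : 'I_k, (i <= i')%N -> (procs i' <= procs i)%N),
      t 0%N = 0 /\ (forall i : 'I_k, t i <= t i.+1),
      (forall j, (forall i, job i <> j) ->
        completion S j = p j /\ forall l, pieces S j l = [::]) &
      (forall i : 'I_k,
        completion S (job i) = t i.+1 /\
        forall l : 'I_m, pieces S (job i) l =
          if (l < procs i)%N then [:: (t i, t i.+1)] else [::])].

(* For a feasible schedule the overlap is the total length of the pieces. *)
Lemma overlapE (R : realType) (J : finType) (m : nat) (p : J -> R)
    (S : schedule R J m) (j : J) (i : 'I_m) :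
  feasible p S -> overlap S j i = \sum_(I <- pieces S j i) piece_length I.
Proof.
move=> fS; rewrite /overlap setIidl; last first.
  by move=> x [I /= Is Ix]; exact: (feasible_in_private fS Is).
have := feasible_same_job fS (j := j) (i := i).
have : forall I, I \in pieces S j i -> I.1 <= I.2 by exact: feasible_piece fS j i.
rewrite /shared_time; move: (pieces S j i) => s le_s triv_s.
rewrite bigcup_seq (big_nth (0, 0)) big_mkord.
rewrite [X in fine X](_ : _ = (\sum_(k < size s)
    lebesgue_measure (piece_time (nth (0, 0)%R s k)))%E); last first.
  apply: (measure_semi_additive_ord_I (@lebesgue_measure R)
    (F := fun k => piece_time (nth (0, 0)%R s k))) => // [k _|]; last first.
    by apply: bigsetU_measurable => k _; exact: measurable_itv.
  exact: measurable_itv.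
rewrite (big_nth (0, 0)) big_mkord.
rewrite (eq_bigr (fun k : 'I_(size s) =>
    (piece_length (nth (0, 0) s k))%:E)); first by rewrite sumEFin.
move=> k _; have := le_s _ (mem_nth (0, 0) (ltn_ord k)).
rewrite /piece_time /piece_length lebesgue_measure_itv /= lte_fin.
by rewrite le_eqVlt => /predU1P[->|->]; rewrite ?ltxx ?subrr ?EFinB.
Qed.

(* Main.v *)
(* In a feasible schedule let x_{j,i} be the total length of job j on M_i.  With
   the jobs listed by completion time, sum_{l <= j} x_{l,i} <= C_j for all i.
   Keep only the loads T_i = sum_j x_{j,i}, let M_i be busy during (0, T_i), and
   let the jobs, in this order, use all busy processors one after the other:
   job j then occupies an interval of length tau_j ending at t_j <= C_j.  So
   every schedule gives a point, of the same value, of the linear program with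
   the constraints 0 <= x_{j,i} <= tau_j and t_j + sum_i x_{j,i} <= p_j, where
   t_j = sum_{l <= j} tau_l.

   Take a basic solution of this program maximizing the value and, among those,
   minimizing sum_j t_j.  After dropping the jobs with x_{j,i} = 0 for all i,
   counting constraints and nonzero variables (slacks included) forces x_{j,i}
   to be 0 or tau_j and t_j = C_j.  By minimality of sum_j t_j, applying the
   rearrangement above once more does not change the t_j; hence
   sum_{l <= j} x_{l,i} = min(T_i, t_j), and the sets {i | x_{j,i} <> 0} decrease
   with j.  Replacing each set by the cheapest processors of the same number
   gives a synchronized schedule. *)
Require Import Defs.
From mathcomp Require Import all_boot all_order all_algebra.
From mathcomp Require Import all_classical all_reals all_analysis.
From mathcomp Require Import ring lra.

Set Implicit Arguments.
Unset Strict Implicit.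
Unset Printing Implicit Defensive.

Import Order.TTheory GRing.Theory Num.Theory.
Import numFieldNormedType.Exports.
Local Open Scope ring_scope.

(** * Basic optimal solutions of linear programs *)

(** With fewer equations than elements of [S], the columns in [S] are linearly dependent; the
    dependency is extended by zero outside [S]. *)
Lemma exists_null_vector (F : fieldType) (I K : finType) (A : K -> I -> F)
    (S : {set I}) :
  (#|K| < #|S|)%N ->
  exists d : I -> F, [/\ exists i, d i != 0,
    forall i, i \notin S -> d i = 0 & forall k, \sum_i A k i * d i = 0].
Proof.
move=> KS; pose M := \matrix_(a < #|S|, b < #|K|) A (enum_val b) (enum_val a).
have /matrix0Pn[a [b kab]] : kermx M != 0.
  by rewrite kermx_eq0 -row_leq_rank -ltnNge (leq_ltn_trans (rank_leq_col _)).
pose u := row a (kermx M).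
have uM : u *m M = 0 by apply/sub_kermxP; exact: row_sub.
exists (fun i => \sum_(h < #|S|) u 0 h * (enum_val h == i)%:R); split.
- exists (enum_val b); rewrite (bigD1 b) //= eqxx mulr1 big1.
    by rewrite addr0 [u 0 b]mxE.
  by move=> h hb; rewrite (inj_eq enum_val_inj) (negbTE hb) mulr0.
- move=> i iS; rewrite big1// => h _; case: eqP => [hi|]; last by rewrite mulr0.
  by move: iS; rewrite -hi enum_valP.
- move=> k; under eq_bigr do rewrite mulr_sumr.
  rewrite exchange_big /=.
  have := congr1 (fun N : 'rV_#|K| => N 0 (enum_rank k)) uM.
  rewrite mxE [RHS]mxE => uMk; rewrite -[RHS]uMk.
  apply: eq_bigr => h _; rewrite (bigD1 (enum_val h)) //= eqxx mulr1 [M h _]mxE.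
  rewrite enum_rankK mulrC big1 ?addr0 // => i.
  by rewrite eq_sym => /negbTE ->; rewrite !mulr0.
Qed.

Definition lp_feasible (R : realType) (I K : finType) (A : K -> I -> R)
    (b : K -> R) (z : I -> R) : Prop :=
  (forall i, 0 <= z i) /\ forall k, \sum_i A k i * z i = b k.

(** The columns of [A] at the nonzero coordinates of [z] are linearly independent: for feasible [z],
    a vertex of the program. *)
Definition basic (R : realType) (I K : finType) (A : K -> I -> R)
    (z : I -> R) : Prop :=
  forall d : I -> R, (forall i, z i = 0 -> d i = 0) ->
    (forall k, \sum_i A k i * d i = 0) -> forall i, d i = 0.

(** Lexicographic comparison: [f] is the objective and [g] breaks ties. *)
Definition lexle (R : realType) (I : finType) (f g : I -> R)
    (z z' : I -> R) : Prop :=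
  \sum_i f i * z i < \sum_i f i * z' i \/
  \sum_i f i * z i = \sum_i f i * z' i /\
    \sum_i g i * z i <= \sum_i g i * z' i.

Lemma lexle_trans (R : realType) (I : finType) (f g : I -> R) z1 z2 z3 :
  lexle f g z1 z2 -> lexle f g z2 z3 -> lexle f g z1 z3.
Proof. by rewrite /lexle; lra. Qed.

Lemma sum_mulrDZ (R : realType) (I : finType) (f z d : I -> R) (s : R) :
  \sum_i f i * (z i + s * d i) = \sum_i f i * z i + s * \sum_i f i * d i.
Proof.
by rewrite mulr_sumr -big_split; apply: eq_bigr => i _ /=; ring.
Qed.

Section LinearProgram.
Variables (R : realType) (I K : finType) (A : K -> I -> R) (b : K -> R).
Variables (f g : I -> R).
Hypothesis null_ge0 : forall d : I -> R, (forall i, 0 <= d i) ->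
  (forall k, \sum_i A k i * d i = 0) -> forall i, d i = 0.

Let supp (z : I -> R) : {set I} := [set i | z i != 0]%SET.

(* A null direction in the support of z, oriented so as not to decrease the
   objective, is followed until a coordinate vanishes; null_ge0, i.e. the
   boundedness of the program, guarantees that this happens. *)
Lemma lp_shrink_support z : lp_feasible A b z -> ~ basic A z ->
  exists z', [/\ lp_feasible A b z', (#|supp z'| < #|supp z|)%N &
                 lexle f g z z'].
Proof.
move=> [z0 zb] nb.
have [d [dz dA [i0 di0] dfg]] : exists d : I -> R,
    [/\ (forall i, z i = 0 -> d i = 0),
        (forall k, \sum_i A k i * d i = 0),
        (exists i, d i != 0) &
        0 < \sum_i f i * d i \/
        0 = \sum_i f i * d i /\ 0 <= \sum_i g i * d i].
  move: nb => /existsNP[d] /not_implyP[dz] /not_implyP[dA] /existsNP[i di].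
  pose P := 0 < \sum_i f i * d i \/
            0 = \sum_i f i * d i /\ 0 <= \sum_i g i * d i.
  have [H|nP] := pselect P.
    by exists d; split => //; exists i; exact/eqP.
  have sumN (h : I -> R) : \sum_i h i * (- d i) = - \sum_i h i * d i.
    by rewrite -sumrN; apply: eq_bigr => ? _; rewrite mulrN.
  exists (fun i => - d i); split.
  - by move=> j /dz ->; rewrite oppr0.
  - by move=> k; rewrite sumN dA oppr0.
  - by exists i; rewrite oppr_eq0; exact/eqP.
  - by rewrite !sumN; move: nP; rewrite /P; lra.
have [i1 di1] : exists i, d i < 0.
  apply: contrapT => /forallNP dge0.
  suff /(_ i0) : forall i, d i = 0 by move/eqP; exact/negP.
  by apply: null_ge0 => // i; rewrite leNgt; exact/negP.
(* Ratio test: [s] is a coordinate that vanishes first along [d], after the step [r]. *)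
pose s := [arg min_(i < i1 | d i < 0) (z i / - d i)]%O.
have sP : d s < 0 /\ forall i, d i < 0 -> z s / - d s <= z i / - d i.
  by rewrite /s; case: arg_minP.
case: sP => ds smin; pose r := z s / - d s.
have r0 : 0 <= r by rewrite divr_ge0// oppr_ge0 ltW.
exists (fun i => z i + r * d i); split.
- split=> [i|k]; last by rewrite sum_mulrDZ dA mulr0 addr0.
  have [di|di] := ltP (d i) 0; last by rewrite addr_ge0// mulr_ge0.
  have := smin _ di; rewrite -/r ler_pdivlMr ?oppr_gt0 //; lra.
- apply/proper_card/properP; split.
    apply/fintype.subsetP => i; rewrite !inE; apply: contraNN => /eqP zi.
    by rewrite zi (dz _ zi) mulr0 addr0.
  exists s; rewrite !inE.
    by apply/eqP => /dz dz0; rewrite dz0 ltxx in ds.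
  by rewrite negbK /r; apply/eqP; field; lra.
- rewrite /lexle !sum_mulrDZ; case: dfg => [fd|[<- gd]].
    have [->|rn0] := eqVneq r 0; first by right; lra.
    by left; rewrite ltrDl mulr_gt0// lt0r rn0.
  by right; rewrite mulr0 addr0; split=> //; rewrite lerDl mulr_ge0.
Qed.

Lemma lp_purify z : lp_feasible A b z ->
  exists z', [/\ lp_feasible A b z', basic A z' & lexle f g z z'].
Proof.
have [n] := ubnP #|supp z|; elim: n z => // n IH z zn fz.
have [bz|nbz] := pselect (basic A z); first by exists z; split => //; right.
have [z1 [fz1 s1 l1]] := lp_shrink_support fz nbz.
have [z2 [fz2 b2 l2]] := IH z1 (leq_trans s1 zn) fz1.
by exists z2; split => //; exact: lexle_trans l1 l2.
Qed.

Lemma basic_eq z z' : lp_feasible A b z -> lp_feasible A b z' ->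
  basic A z -> supp z = supp z' -> z =1 z'.
Proof.
move=> [_ zb] [_ zb'] bz ss i; apply/eqP; rewrite -subr_eq0; apply/eqP.
apply: (bz (fun i => z i - z' i)) => {i} [i zi|k].
  move/setP: ss => /(_ i); rewrite !inE zi eqxx /= => /esym/negbFE/eqP ->.
  by rewrite subrr.
under eq_bigr do rewrite mulrBr.
by rewrite sumrB zb zb' subrr.
Qed.

(* A basic solution is determined by its support, so there are only finitely
   many candidates for the maximum. *)
Lemma lp_lexmax z0 : lp_feasible A b z0 ->
  exists z, [/\ lp_feasible A b z,
    (forall z', lp_feasible A b z' -> lexle f g z' z) &
    (#|[set i | z i != 0%R]%SET| <= #|K|)%N].
Proof.
move=> fz0.
pose P (S : {set I}) z := [/\ lp_feasible A b z, basic A z & supp z = S].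
have [v vP] : {v : {set I} -> I -> R & forall S z, P S z -> P S (v S)}.
  apply: (choice (P := fun S v => forall z, P S z -> P S v)) => S.
  have [[z Pz]|nP] := pselect (exists z, P S z); first by exists z.
  by exists z0 => z Pz; exfalso; apply: nP; exists z.
pose Q := fun S => `[< P S (v S) >].
have [z1 [fz1 bz1 _]] := lp_purify fz0.
have QP z : lp_feasible A b z -> basic A z -> Q (supp z).
  by move=> fz bz; apply/asboolP; apply: (vP _ z).
pose obj z : R *l R := (\sum_i f i * z i, \sum_i g i * z i).
have lexleE z z' : (obj z <= obj z')%O -> lexle f g z z'.
  rewrite /obj Order.ProdLexiOrder.leEprodlexi /= /lexle.
  by move=> /andP[fl /implyP gl]; lra.
pose S := [arg max_(S > supp z1 | Q S) obj (v S)]%O.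
have [QS Smax] : Q S /\ forall S', Q S' -> (obj (v S') <= obj (v S))%O.
  by rewrite /S; case: Order.TotalTheory.arg_maxP => //; exact: QP.
have /asboolP[fS bS sS] := QS.
exists (v S); split => // [z fz|].
  have [z2 [fz2 bz2 l2]] := lp_purify fz.
  apply: (lexle_trans l2); apply: lexleE.
  have Q2 := QP _ fz2 bz2.
  have /asboolP[fv bv sv] := Q2.
  have -> : obj z2 = obj (v (supp z2)).
    have e := basic_eq fz2 fv bz2 (esym sv).
    by rewrite /obj; congr (_, _); apply: eq_bigr => i _; rewrite e.
  exact: Smax.
(* A support larger than the number of equations would carry a nonzero null direction, against
   [bS]. *)
rewrite leqNgt; apply/negP => lt.
have [d [[i di] dS dA]] := exists_null_vector A lt.
suff d0 : d i = 0 by rewrite d0 eqxx in di.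
by apply: bS => // j vj; apply: dS; rewrite inE vj eqxx.
Qed.

End LinearProgram.

(** * The linear program of a sequence of jobs *)

(* The jobs 0, ..., k - 1 run one after the other, job l during tau l units of
   time, and x l i is the part of this time used on processor i.  The last
   inequality allows idling, so that the completion time is q j - sum_i x j i,
   which may exceed the end sum_{l <= j} tau l of the work of j. *)
Definition seq_feasible (R : realType) (k m : nat) (q : 'I_k -> R)
    (tau : 'I_k -> R) (x : 'I_k -> 'I_m -> R) : Prop :=
  [/\ forall j, 0 <= tau j,
      forall j i, 0 <= x j i <= tau j &
      forall j : 'I_k, \sum_(l < k | (l <= j)%N) tau l + \sum_i x j i <= q j].

Definition seq_value (R : realType) (k m : nat) (v : 'I_k -> R)
    (c : 'I_m -> R) (x : 'I_k -> 'I_m -> R) : R :=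
  \sum_j \sum_i x j i * (v j - c i).

Definition sum_ends (R : realType) (k : nat) (tau : 'I_k -> R) : R :=
  \sum_(j < k) \sum_(l < k | (l <= j)%N) tau l.

Lemma sum_mul_eq (R : pzRingType) (I : finType) (a : I) (F : I -> R) :
  \sum_i (i == a)%:R * F i = F a.
Proof.
rewrite (bigD1 a) //= eqxx mul1r big1 ?addr0 // => i /negbTE ->.
by rewrite mul0r.
Qed.

Section SequenceLP.
Variables (R : realType) (k m : nat) (q v : 'I_k -> R) (c : 'I_m -> R).

(* The blocks of variables: x, tau - x, tau, and the slack of the deadlines. *)
Let I := (('I_k * 'I_m + 'I_k * 'I_m) + ('I_k + 'I_k))%type.
Let K := ('I_k * 'I_m + 'I_k)%type.

(** Rows [inl (j, i)] tie the first three blocks by x + (tau - x) = tau; rows [inr j] are the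
    deadlines, turned into equations by the slacks. *)
Let A (h : K) (e : I) : R :=
  match h, e with
  | inl r, inl (inl s) => (s == r)%:R
  | inl r, inl (inr s) => (s == r)%:R
  | inl r, inr (inl l) => - (l == r.1)%:R
  | inl r, inr (inr l) => 0
  | inr j, inl (inl s) => (s.1 == j)%:R
  | inr j, inl (inr s) => 0
  | inr j, inr (inl l) => (l <= j)%N%:R
  | inr j, inr (inr l) => (l == j)%:R
  end.

Let b (h : K) : R := if h is inr j then q j else 0.

Let f (e : I) : R := if e is inl (inl s) then v s.1 - c s.2 else 0.

(** The sign turns minimizing [sum_ends] into maximizing; [tau l] counts in the end of every job [j]
    with [l <= j]. *)
Let g (e : I) : R :=
  if e is inr (inl l) then - \sum_(j < k) (l <= j)%N%:R else 0.

Let sumA_inl (z : I -> R) (j : 'I_k) (i : 'I_m) :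
  \sum_e A (inl (j, i)) e * z e =
  z (inl (inl (j, i))) + z (inl (inr (j, i))) - z (inr (inl j)).
Proof.
rewrite !big_sumType /= !sum_mul_eq; congr (_ + _).
under [X in _ + X]eq_bigr do rewrite mul0r.
rewrite big1_eq addr0; under eq_bigr do rewrite mulNr.
by rewrite sumrN sum_mul_eq.
Qed.

Let sumA_inr (z : I -> R) (j : 'I_k) :
  \sum_e A (inr j) e * z e =
  \sum_i z (inl (inl (j, i))) +
    (\sum_(l < k | (l <= j)%N) z (inr (inl l)) + z (inr (inr j))).
Proof.
rewrite !big_sumType /= sum_mul_eq; congr (_ + (_ + _)).
- under [X in _ + X]eq_bigr do rewrite mul0r.
  rewrite big1_eq addr0.
  transitivity (\sum_l (l == j)%:R * \sum_i z (inl (inl (l, i)))).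
    under [RHS]eq_bigr do rewrite mulr_sumr.
    by rewrite pair_bigA /=; apply: eq_bigr => -[].
  by rewrite sum_mul_eq.
- by rewrite [RHS]big_mkcond; apply: eq_bigr => l _; case: ifP => _;
    rewrite ?mul1r ?mul0r.
Qed.

Let sumf (z : I -> R) :
  \sum_e f e * z e = seq_value v c (fun j i => z (inl (inl (j, i)))).
Proof.
rewrite !big_sumType /=.
under [X in _ + X + _]eq_bigr do rewrite mul0r.
under [X in _ + (X + _)]eq_bigr do rewrite mul0r.
under [X in _ + (_ + X)]eq_bigr do rewrite mul0r.
rewrite !big1_eq !addr0 /seq_value pair_bigA /=.
by apply: eq_bigr => -[j i] _; rewrite mulrC.
Qed.

Let sumg (z : I -> R) :
  \sum_e g e * z e = - sum_ends (fun j => z (inr (inl j))).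
Proof.
rewrite !big_sumType /=.
under eq_bigr do rewrite mul0r.
under [X in _ + X + _]eq_bigr do rewrite mul0r.
under [X in _ + (_ + X)]eq_bigr do rewrite mul0r.
rewrite !big1_eq !add0r addr0 /sum_ends.
under eq_bigr do rewrite mulNr mulr_suml.
rewrite sumrN exchange_big /=; congr (- _); apply: eq_bigr => j _.
rewrite [RHS]big_mkcond; apply: eq_bigr => l _; case: ifP => _;
    by rewrite ?mul1r ?mul0r.
Qed.

(** A deadline row with right-hand side 0 is a sum of nonnegative terms, so all its variables
    vanish; the other rows then kill tau - x. *)
Let null_ge0 (d : I -> R) : (forall e, 0 <= d e) ->
  (forall h, \sum_e A h e * d e = 0) -> forall e, d e = 0.
Proof.
move=> d0 dA.
have H j : [/\ forall i, d (inl (inl (j, i))) = 0, d (inr (inl j)) = 0 &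
               d (inr (inr j)) = 0].
  have := dA (inr j); rewrite sumA_inr => /eqP.
  rewrite paddr_eq0 ?sumr_ge0 ?addr_ge0 ?sumr_ge0 //.
  rewrite paddr_eq0 ?sumr_ge0 // => /and3P[]; rewrite !psumr_eq0 //.
  move=> /allP xj /allP tj /eqP ->; split => // [i|].
    by apply/eqP/(implyP (xj i _)) => //; rewrite mem_index_enum.
  by apply/eqP/(implyP (tj j _)) => //; rewrite mem_index_enum.
case=> [[[j i]|[j i]]|[j|j]]; have [x0 t0 s0] := H j => //.
have := dA (inl (j, i)); rewrite sumA_inl x0 t0; lra.
Qed.

(** If every [tau j] is positive, these and, for each pair, one of x and tau - x are nonzero:
    already the [#|K|] variables that [lp_lexmax] allows. All others vanish. *)
Lemma seq_lexmax : (forall j, 0 <= q j) ->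
  exists tau x, [/\ seq_feasible q tau x,
    forall tau' x', seq_feasible q tau' x' ->
      seq_value v c x' < seq_value v c x \/
      seq_value v c x' = seq_value v c x /\ sum_ends tau <= sum_ends tau' &
    (forall j, 0 < tau j) ->
      (forall j i, x j i = 0 \/ x j i = tau j) /\
      (forall j : 'I_k, \sum_(l < k | (l <= j)%N) tau l + \sum_i x j i = q j)].
Proof.
move=> q0.
pose lift_sol (tau : 'I_k -> R) (x : 'I_k -> 'I_m -> R) (e : I) : R :=
  match e with
  | inl (inl s) => x s.1 s.2
  | inl (inr s) => tau s.1 - x s.1 s.2
  | inr (inl j) => tau j
  | inr (inr j) => q j - (\sum_(l < k | (l <= j)%N) tau l + \sum_i x j i)
  end.
have liftP tau x : seq_feasible q tau x -> lp_feasible A b (lift_sol tau x).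
  move=> [t0 xt tq]; split.
    by case=> [[[j i]|[j i]]|[j|j]] //=; rewrite ?subr_ge0 //;
      have /andP[] := xt j i.
  case=> [[j i]|j]; rewrite ?sumA_inl ?sumA_inr /=; first by ring.
  by ring.
have z0 : seq_feasible q (fun=> 0) (fun (_ : 'I_k) (_ : 'I_m) => 0).
  by split=> // [*|j]; rewrite ?lexx // !big1_eq addr0.
have [z [[zge0 zA] zmax zs]] := lp_lexmax f g null_ge0 (liftP _ _ z0).
have zxy j i : z (inl (inl (j, i))) + z (inl (inr (j, i))) = z (inr (inl j)).
  by have := zA (inl (j, i)); rewrite sumA_inl /=; lra.
have zq j : \sum_i z (inl (inl (j, i))) +
    (\sum_(l < k | (l <= j)%N) z (inr (inl l)) + z (inr (inr j))) = q j.
  by have := zA (inr j); rewrite sumA_inr.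
exists (fun j => z (inr (inl j))), (fun j i => z (inl (inl (j, i)))); split.
- split=> [j|j i|j] //; first by rewrite -(zxy j i) lerDl !zge0.
  by rewrite -zq addrCA addrA lerDl.
- by move=> tau x /liftP /zmax; rewrite /lexle !sumf !sumg /= lerN2.
move=> t0.
(* With #|K| constraints, the #|K| variables selected by phi are all the
   nonzero ones. *)
pose phi (h : K) : I := match h with
  | inl s => if z (inl (inl s)) != 0 then inl (inl s) else inl (inr s)
  | inr j => inr (inl j) end.
have phi_inj : injective phi.
  move=> [s|j] [s'|j'] //=; last by move=> [->].
  - by case: ifP => _; case: ifP => _ // [->].
  - by case: ifP.
  - by case: ifP.
have imphi : phi @: [set: K] = [set i | z i != 0]%SET.
  apply/eqP; rewrite eqEcard card_imset // cardsT zs andbT.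
  apply/fintype.subsetP => _ /imsetP[[[j i]|j] _ ->]; rewrite inE /=;
    last by rewrite gt_eqF.
  case: ifPn => // /negbNE/eqP x0.
  by have := zxy j i; rewrite x0 add0r => ->; rewrite gt_eqF.
split=> [j i|j].
  have [|x0] := eqVneq (z (inl (inl (j, i)))) 0; [by left|right].
  have /setP/(_ (inl (inr (j, i)))) := imphi.
  rewrite inE -(zxy j i); have [->|] := eqVneq (z (inl (inr (j, i)))) 0.
    by rewrite addr0.
  move=> _ /imsetP[[[j' i']|j'] _] //=; case: ifPn => // + [je ie].
  by rewrite -je -ie x0.
have /setP/(_ (inr (inr j))) := imphi.
rewrite inE; have [s0 _|] := eqVneq (z (inr (inr j))) 0.
  by rewrite -zq s0 addr0 addrC.
by move=> _ /imsetP[[[j' i']|j'] _] //=; case: ifPn.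
Qed.

End SequenceLP.

(** * Rearranging the work *)

Lemma sum_prefix_recr (V : zmodType) (k : nat) (F : 'I_k -> V) (j : 'I_k) :
  \sum_(l < k | (l < j.+1)%N) F l = \sum_(l < k | (l < j)%N) F l + F j.
Proof.
rewrite (bigD1 j) //= addrC; congr (_ + _).
by apply: eq_bigl => l; rewrite ltnS andbC ltn_neqAle.
Qed.

Lemma telescope_prefix (V : zmodType) (k n : nat) (G : nat -> V) :
  (n <= k)%N -> \sum_(l < k | (l < n)%N) (G l.+1 - G l) = G n - G 0%N.
Proof.
move=> nk; rewrite -(big_ord_widen k (fun l => G l.+1 - G l) nk).
by rewrite -(big_mkord predT (fun l => G l.+1 - G l)) telescope_sumr.
Qed.

Lemma sum_min_IVT (R : realType) (m : nat) (T : 'I_m -> R) (a b w : R) :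
  a <= b -> \sum_i Num.min (T i) a <= w <= \sum_i Num.min (T i) b ->
  exists2 t, a <= t <= b & \sum_i Num.min (T i) t = w.
Proof.
move=> ab /andP[aw wb].
have ct : continuous (fun t : R => \sum_i Num.min (T i) t).
  move=> t; apply: cvg_big => [|i _]; first exact: add_continuous.
  by apply: continuous_min; [exact: cvg_cst|exact: cvg_id].
have [|t tab <-] := IVT ab (continuous_subspaceT ct) (v := w).
  by rewrite ge_min aw le_max wb orbT.
by exists t => //; move: tab; rewrite in_itv.
Qed.

Lemma min_increment (R : realType) (T a b : R) : a <= b ->
  0 <= Num.min T b - Num.min T a <= b - a.
Proof. by move=> ab; case: (leP T a); case: (leP T b); lra. Qed.

Section Rearrange.
Variables (R : realType) (k m : nat) (x : 'I_k -> 'I_m -> R) (D : 'I_k -> R).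
Hypothesis x_ge0 : forall j i, 0 <= x j i.
Hypothesis D_ge0 : forall j, 0 <= D j.
Hypothesis D_homo : forall j j' : 'I_k, (j <= j')%N -> D j <= D j'.
Hypothesis x_prefix : forall (j : 'I_k) i,
  \sum_(l < k | (l <= j)%N) x l i <= D j.

Let T i := \sum_l x l i.
Let phi t := \sum_i Num.min (T i) t.
Let W n := \sum_(l < k | (l < n)%N) \sum_i x l i.

Let T_ge0 i : 0 <= T i. Proof. by rewrite sumr_ge0. Qed.

Let prefix_le_T (P : pred 'I_k) i : \sum_(l | P l) x l i <= T i.
Proof. by rewrite /T [leRHS](bigID P) /= lerDl sumr_ge0. Qed.

(** [phi u] is the work done by time [u] when processor i is busy during (0, T i). The intermediate
    value theorem gives the next finishing time between [t n] and [D j]: the first n + 1 jobs load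
    processor i by at most [T i] and [D j], so [W n.+1 <= phi (D j)]. *)
Let finishing_times (n : nat) : (n <= k)%N ->
  exists t : nat -> R, [/\ t 0%N = 0,
    forall l, (l < n)%N -> t l <= t l.+1,
    forall l, (l <= n)%N -> phi (t l) = W l &
    forall j : 'I_k, (j < n)%N -> t j.+1 <= D j].
Proof.
elim: n => [_|n IH nk].
  exists (fun=> 0); split => // l; rewrite leqn0 => /eqP ->.
  rewrite /W big_pred0 // /phi big1 // => i _.
  exact/min_idPr.
have [t [t0 tm tW tD]] := IH (ltnW nk); pose j := Ordinal nk.
have tnD : t n <= D j.
  have [->|n0] := posnP n; first by rewrite t0.
  have n1k : (n.-1 < k)%N by rewrite (leq_ltn_trans (leq_pred n) nk).
  have := tD (Ordinal n1k); rewrite /= prednK // => /(_ (leqnn n)) tD1.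
  by apply: (le_trans tD1); apply: D_homo; exact: leq_pred.
have [|u /andP[tu uD] uW] := sum_min_IVT tnD (T := T) (w := W n.+1).
  rewrite -/(phi (t n)) tW // /W (sum_prefix_recr _ j) lerDl sumr_ge0 //=.
  rewrite -(sum_prefix_recr _ j) exchange_big /=; apply: ler_sum => i _.
  by rewrite le_min prefix_le_T; exact: (x_prefix j i).
exists (fun l => if l == n.+1 then u else t l); split => //.
- move=> l; rewrite ltnS leq_eqVlt => /predU1P[->|ln].
    by rewrite eqxx ltn_eqF.
  by rewrite !ltn_eqF ?tm // ltnS // ltnW.
- move=> l; rewrite leq_eqVlt => /predU1P[->|ln]; first by rewrite eqxx.
  by rewrite ltn_eqF // tW.
- move=> j'; rewrite ltnS leq_eqVlt => /predU1P[j'n|j'n].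
    by rewrite j'n eqxx; apply: (le_trans uD); apply: D_homo; rewrite j'n.
  by rewrite ltn_eqF ?ltnS // tD.
Qed.

(* The processors share the load as if processor i were busy exactly during
   (0, T i); the jobs use the available processors one after the other. *)
Lemma rearrange : exists tau (x' : 'I_k -> 'I_m -> R),
  [/\ forall j i, 0 <= x' j i <= tau j,
      forall j, 0 <= tau j,
      forall j, \sum_i x' j i = \sum_i x j i,
      forall i, \sum_j x' j i = \sum_j x j i &
      forall j : 'I_k, \sum_(l < k | (l <= j)%N) tau l <= D j /\
        \sum_i Num.min (\sum_l x l i) (\sum_(l < k | (l <= j)%N) tau l) =
        \sum_(l < k | (l <= j)%N) \sum_i x l i].
Proof.
have [t [t0 tm tW tD]] := finishing_times (leqnn k).
exists (fun j => t j.+1 - t j).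
(* Job [j] gets from processor i the part of (0, T i) that lies between [t j] and [t j.+1]. *)
exists (fun j i => Num.min (T i) (t j.+1) - Num.min (T i) (t j)).
have tele (j : 'I_k) : \sum_(l < k | (l <= j)%N) (t l.+1 - t l) = t j.+1.
  by have := telescope_prefix t (ltn_ord j); rewrite t0 subr0.
split.
- by move=> j i; apply: min_increment; exact: tm.
- by move=> j; rewrite subr_ge0 tm.
- move=> j; rewrite sumrB -!/(phi _) !tW ?(ltnW (ltn_ord j)) //.
  by rewrite /W sum_prefix_recr addrC addKr.
- move=> i.
  have -> : \sum_(j < k) (Num.min (T i) (t j.+1) - Num.min (T i) (t j)) =
            Num.min (T i) (t k) - Num.min (T i) (t 0%N).
    rewrite -(telescope_prefix (fun l => Num.min (T i) (t l)) (leqnn k)).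
    by apply: eq_bigl => l; rewrite ltn_ord.
  rewrite t0 (min_idPr (T_ge0 i)) subr0.
  (* The terms are nonnegative and sum to 0, so every processor has done its whole load by time
     [t k]. *)
  have : \sum_i (T i - Num.min (T i) (t k)) = 0.
    rewrite sumrB -/(phi _) tW // /W [X in _ - X](eq_bigl xpredT).
      by rewrite exchange_big subrr.
    by move=> l; rewrite ltn_ord.
  move/eqP; rewrite psumr_eq0 => [|? _]; last by rewrite subr_ge0 ge_min lexx.
  by move=> /allP/(_ i (mem_index_enum _))/=; rewrite subr_eq0 => /eqP <-.
- by move=> j; rewrite tele; split; [exact: tD|exact: tW].
Qed.

End Rearrange.

(** * Optimal solutions with nested processor sets *)

(** Row and column sums alone determine the value, which is why [rearrange] preserves it. *)
Lemma seq_valueE (R : realType) (k m : nat) (v : 'I_k -> R) (c : 'I_m -> R)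
    (x : 'I_k -> 'I_m -> R) :
  seq_value v c x =
  \sum_j v j * \sum_i x j i - \sum_i c i * \sum_j x j i.
Proof.
rewrite /seq_value; under [X in _ - X]eq_bigr do rewrite mulr_sumr.
rewrite [X in _ - X]exchange_big -sumrB /=; apply: eq_bigr => j _.
by rewrite mulr_sumr -sumrB; apply: eq_bigr => i _; ring.
Qed.

Lemma seq_feasible_lift (R : realType) (k m : nat) (q tau : 'I_k.+1 -> R)
    (x : 'I_k.+1 -> 'I_m -> R) (j0 : 'I_k.+1) :
  seq_feasible q tau x ->
  seq_feasible (q \o lift j0) (tau \o lift j0) (x \o lift j0).
Proof.
move=> [t0 xt tq]; split=> [j|j i|j] /=; [exact: t0|exact: xt|].
apply: le_trans (tq (lift j0 j)); rewrite lerD2r.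
rewrite big_mkcond [leRHS]big_mkcond (bigD1_ord j0) //=.
under [X in _ + X]eq_bigr do rewrite leq_bump2.
by rewrite lerDr; case: ifP.
Qed.

(** Data of a synchronized schedule, except that the processors of a job need not form an initial
    segment. *)
Definition normal (R : realType) (k m : nat) (q tau : 'I_k -> R)
    (x : 'I_k -> 'I_m -> R) : Prop :=
  [/\ forall j, 0 < tau j,
      forall j i, x j i = 0 \/ x j i = tau j,
      forall j : 'I_k,
        \sum_(l < k | (l <= j)%N) tau l + \sum_i x j i = q j,
      forall j, exists i, x j i != 0 &
      forall (j j' : 'I_k) i, (j <= j')%N -> x j i = 0 -> x j' i = 0].

Lemma lexmax_nested (R : realType) (k m : nat) (q v tau : 'I_k -> R)
    (c : 'I_m -> R) (x : 'I_k -> 'I_m -> R) :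
  seq_feasible q tau x ->
  (forall tau' x', seq_feasible q tau' x' ->
     seq_value v c x' < seq_value v c x \/
     seq_value v c x' = seq_value v c x /\ sum_ends tau <= sum_ends tau') ->
  (forall j, 0 < tau j) ->
  forall (j j' : 'I_k) i, (j <= j')%N -> x j i = 0 -> x j' i = 0.
Proof.
move=> [t0 xt tq] lexmax tpos.
pose D (j : 'I_k) := \sum_(l < k | (l <= j)%N) tau l.
have x0 j i : 0 <= x j i by have /andP[] := xt j i.
have D0 j : 0 <= D j by rewrite sumr_ge0.
have Dh (j j' : 'I_k) : (j <= j')%N -> D j <= D j'.
  move=> jj'; rewrite /D big_mkcond [leRHS]big_mkcond; apply: ler_sum => l _.
  by case: leqP => [lj|_]; [rewrite (leq_trans lj jj')|case: ifP].
have xD (j : 'I_k) i : \sum_(l < k | (l <= j)%N) x l i <= D j.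
  by apply: ler_sum => l _; have /andP[] := xt l i.
have [tau' [x' [x't' t'0 row col ends]]] := rearrange x0 D0 Dh xD.
have f' : seq_feasible q tau' x'.
  split=> // j; apply: le_trans (tq j); rewrite row lerD2r.
  by have [] := ends j.
have V : seq_value v c x' = seq_value v c x.
  rewrite !seq_valueE; under eq_bigr do rewrite row.
  by under [X in _ - X]eq_bigr do rewrite col.
(* No end gets later, and by minimality their sum does not drop, so each end is unchanged. *)
have endsE (j : 'I_k) : \sum_(l < k | (l <= j)%N) tau' l = D j.
  have [|[_]] := lexmax _ _ f'; first by rewrite V ltxx.
  rewrite -subr_le0 -sumrB => le0.
  have ge0 (h : 'I_k) : true -> 0 <= D h - \sum_(l < k | (l <= h)%N) tau' l.
    by rewrite subr_ge0; have [] := ends h.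
  have /eqP : \sum_(h < k) (D h - \sum_(l < k | (l <= h)%N) tau' l) = 0.
    by apply/eqP; rewrite eq_le le0 sumr_ge0.
  rewrite psumr_eq0 // => /allP/(_ j (mem_index_enum _))/=.
  by rewrite subr_eq0 => /eqP.
have prefixE (j : 'I_k) i :
    \sum_(l < k | (l <= j)%N) x l i = Num.min (\sum_l x l i) (D j).
  have [_ /eqP] := ends j; rewrite endsE exchange_big /= -subr_eq0 -sumrB.
  rewrite psumr_eq0 => [|h _].
    move=> /allP/(_ i (mem_index_enum _))/=.
    by rewrite subr_eq0 => /eqP.
  rewrite subr_ge0 le_min xD andbT [leRHS](bigID (fun l : 'I_k => (l <= j)%N)).
  by rewrite lerDl sumr_ge0.
move=> j j' i; rewrite leq_eqVlt => /predU1P[/val_inj <- //|jj'] xji.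
(* A processor skipping job [j] has prefix load below [D j]; by [prefixE] this is its whole load, so
   nothing is left for later jobs. *)
have ltD : \sum_(l < k | (l <= j)%N) x l i < D j.
  have recr (F : 'I_k -> R) : \sum_(l < k | (l <= j)%N) F l =
      \sum_(l < k | (l < j)%N) F l + F j by exact: sum_prefix_recr.
  rewrite /D !recr xji addr0 ltr_pwDr //.
  by apply: ler_sum => l _; have /andP[] := xt l i.
have : \sum_l x l i <= \sum_(l < k | (l <= j)%N) x l i.
  by move: ltD; rewrite prefixE gt_min ltxx orbF => /ltW/min_idPl ->.
rewrite [leLHS](bigID (fun l : 'I_k => (l <= j)%N)) /= gerDl.
rewrite (bigD1 j') -?ltnNge //= => le0.
apply/eqP; rewrite eq_le x0 andbT (le_trans _ le0) // lerDl sumr_ge0 //.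
Qed.

(** Induction on the number of jobs: a job without shared work in an optimal solution is dropped at
    no loss; once there is none, every [tau j] is positive and the extremal properties apply. *)
Lemma exists_normal (R : realType) (J : finType) (m : nat) (p w : J -> R)
    (c : 'I_m -> R) (p_ge0 : forall j, 0 <= p j) (k : nat) (job : 'I_k -> J)
    (tau : 'I_k -> R) (x : 'I_k -> 'I_m -> R) :
  injective job -> seq_feasible (p \o job) tau x ->
  exists k' (job' : 'I_k' -> J) tau' x',
    [/\ injective job', normal (p \o job') tau' x' &
        seq_value (w \o job) c x <= seq_value (w \o job') c x'].
Proof.
elim: k => [|k IH] in job tau x *; move=> inj_job fx;
  have [|tau1 [x1 [fx1 lexmax extremal]]] :=
    seq_lexmax (w \o job) c (q := p \o job) => [j|]; do ?exact: p_ge0;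
  have le1 : seq_value (w \o job) c x <= seq_value (w \o job) c x1
    by (have [/ltW|[->]] := lexmax _ _ fx).
  by exists 0%N, job, tau1, x1; split => //; split => -[].
have [t0 xt tq] := fx1.
have [[j0 xj0]|/forallNP xn0] := pselect (exists j0, forall i, x1 j0 i = 0).
  have inj' : injective (job \o lift j0).
    by apply: inj_comp => //; exact: lift_inj.
  have [k' [job' [tau' [x' [ij' n' le']]]]] :=
    IH _ _ _ inj' (seq_feasible_lift j0 fx1).
  exists k', job', tau', x'; split => //; apply: (le_trans le1).
  apply: le_trans le'; rewrite /seq_value (bigD1_ord j0) //= big1 ?add0r //.
  by move=> i _; rewrite xj0 mul0r.
have xpos j : exists i, x1 j i != 0.
  by have /existsNP[i /eqP] := xn0 j; exists i.
have tpos j : 0 < tau1 j.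
  have [i xji] := xpos j; have /andP[x0 xle] := xt j i.
  by rewrite (lt_le_trans _ xle) // lt0r xji.
have [x01 tight] := extremal tpos.
exists k.+1, job, tau1, x1; split => //; split => //.
exact: lexmax_nested fx1 lexmax tpos.
Qed.

(** * From normal solutions to synchronized schedules, and back *)

Lemma sum_first_ord (V : zmodType) (m h : nat) (a : V) :
  (h <= m)%N -> \sum_(l < m | (l < h)%N) a = a *+ h.
Proof.
by move=> hm; rewrite -(big_ord_widen m (fun=> a) hm) sumr_const card_ord.
Qed.

(** Both sums have [#|H|] terms, so [theta], the largest cost on the left, can be subtracted
    throughout. The left side then collects every negative term and no positive one. *)
Lemma sum_first_le (R : realType) (m : nat) (c : 'I_m -> R) (H : {set 'I_m}) :
  (forall i i' : 'I_m, (i <= i')%N -> c i <= c i') ->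
  \sum_(l < m | (l < #|H|)%N) c l <= \sum_(i in H) c i.
Proof.
move=> c_sorted; have Hm : (#|H| <= m)%N by rewrite -[leqRHS]card_ord max_card.
have [H0|H_gt0] := posnP #|H|.
  by rewrite (cards0_eq H0) cards0 big_set0 big_pred0.
have Hm1 : (#|H|.-1 < m)%N by rewrite prednK.
pose theta := c (Ordinal Hm1).
have shift (P : pred 'I_m) : \sum_(i | P i) theta = theta *+ #|H| ->
    \sum_(i | P i) c i = \sum_(i | P i) (c i - theta) + theta *+ #|H|.
  by move=> <-; rewrite -big_split; apply: eq_bigr => i _ /=; rewrite subrK.
rewrite (shift (fun l => (l < #|H|)%N)) ?sum_first_ord //.
rewrite (shift (mem H)) ?sumr_const // lerD2r.
rewrite big_mkcond [leRHS]big_mkcond; apply: ler_sum => i _.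
have le_theta : (i < #|H|)%N -> c i - theta <= 0.
  by move=> iH; rewrite subr_le0; apply: c_sorted; rewrite -ltnS /= prednK.
have ge_theta : ~~ (i < #|H|)%N -> 0 <= c i - theta.
  rewrite -leqNgt subr_ge0 => iH; apply: c_sorted.
  by rewrite (leq_trans (leq_pred _)).
by case: ifP => [/le_theta|/negbT/ge_theta]; case: ifP.
Qed.

Lemma sum_over_injection (V : zmodType) (L J : finType) (f : L -> J)
    (G : J -> V) :
  injective f -> (forall a, (forall l, f l <> a) -> G a = 0) ->
  \sum_a G a = \sum_l G (f l).
Proof.
move=> inj_f G0; rewrite [RHS](partition_big f predT) //=.
apply: eq_bigr => a _; have [l /eqP fl|nf] := pickP (fun l => f l == a).
  rewrite (big_pred1 l) ?fl // => l'.
  by rewrite -fl (inj_eq inj_f).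
by rewrite big_pred0 // G0 // => l /eqP; rewrite nf.
Qed.

Section NormalSchedule.
Variables (R : realType) (J : finType) (m k : nat) (p w : J -> R).
Variables (c : 'I_m -> R) (job : 'I_k -> J).
Variables (tau : 'I_k -> R) (x : 'I_k -> 'I_m -> R).
Hypothesis p_ge0 : forall j, 0 <= p j.
Hypothesis c_sorted : forall i i' : 'I_m, (i <= i')%N -> c i <= c i'.
Hypothesis job_inj : injective job.
Hypothesis normal_x : normal (p \o job) tau x.

Let t (n : nat) := \sum_(l < k | (l < n)%N) tau l.
Let H (j : 'I_k) : {set 'I_m} := [set i | x j i != 0]%SET.
Let procs (j : 'I_k) := #|H j|.
Let index (a : J) := [pick j | job j == a].

Let S : schedule R J m := Schedule
  (fun a (l : 'I_m) => if index a is Some j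
    then if (l < procs j)%N then [:: (t j, t j.+1)] else [::] else [::])
  (fun a => if index a is Some j then t j.+1 else p a).

Let index_job j : index (job j) = Some j.
Proof.
rewrite /index; case: pickP => [j' /eqP/job_inj -> //|/(_ j)].
by rewrite eqxx.
Qed.

Let index_None a : (forall j, job j <> a) -> index a = None.
Proof. by rewrite /index; case: pickP => // j /eqP ja /(_ j). Qed.

Let indexP a : (exists2 j, job j = a & index a = Some j) \/
  (forall j, job j <> a) /\ index a = None.
Proof.
rewrite /index; case: pickP => [j /eqP ja|nj]; first by left; exists j.
by right; split => // j /eqP; rewrite nj.
Qed.

Let tau_ge0 j : 0 <= tau j.
Proof. by have [tpos _ _ _ _] := normal_x; exact: ltW. Qed.

Let tS (j : 'I_k) : t j.+1 = t j + tau j.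
Proof. exact: sum_prefix_recr. Qed.

Let t_homo n n' : (n <= n')%N -> t n <= t n'.
Proof.
move=> nn'; rewrite /t big_mkcond [leRHS]big_mkcond; apply: ler_sum => l _.
by case: ltnP => [ln|_]; [rewrite (leq_trans ln nn')|case: ifP].
Qed.

Let t_ge0 n : 0 <= t n.
Proof. exact: sumr_ge0. Qed.

Let procs_le j : (procs j <= m)%N.
Proof. by rewrite -[leqRHS]card_ord max_card. Qed.

Let xE j i : x j i = if i \in H j then tau j else 0.
Proof.
have [_ x01 _ _ _] := normal_x.
rewrite inE; case: eqVneq (x01 j i) => [-> //|xn0 [/eqP|//]].
by rewrite (negbTE xn0).
Qed.

Let mem_pieces a l I : I \in pieces S a l ->
  exists2 j, job j = a & I = (t j, t j.+1).
Proof.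
rewrite /=; have [[j ja ->]|[_ -> //]] := indexP a.
by case: ifP => // _; rewrite inE => /eqP ->; exists j.
Qed.

Let sum_pieces j (l : 'I_m) : \sum_(I <- pieces S (job j) l) piece_length I =
  if (l < procs j)%N then tau j else 0.
Proof.
rewrite /= index_job; case: ifP => _; last by rewrite big_nil.
by rewrite big_seq1 /piece_length /= tS addrC addKr.
Qed.

Let feasible_S : feasible p S.
Proof.
have [tpos _ tight _ _] := normal_x.
split.
- by move=> a /=; case: (index a).
- by move=> a l I /mem_pieces[j _ ->]; exact: t_homo.
- move=> a l n n'; have : (size (pieces S a l) <= 1)%N.
    by rewrite /=; case: (index a) => // j; case: ifP.
  by case: size => [|[|]] //= _; rewrite !ltnS !leqn0 => /eqP -> /eqP ->.
- move=> a; have [[j <- _]|[_ ai]] := indexP a; last first.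
    by rewrite /= ai big1 ?addr0 // => i _; rewrite big_nil.
  rewrite -[RHS](tight j) [completion _ _]/= index_job; congr (_ + _).
  under eq_bigr do rewrite sum_pieces.
  under [RHS]eq_bigr do rewrite xE.
  by rewrite -!big_mkcond sum_first_ord // sumr_const.
- move=> l a b _ _ [y [[I aI yI] [I' bI' yI']]].
  have [j ja eI] := mem_pieces aI; have [j' jb eI'] := mem_pieces bI'.
  move: yI yI'; rewrite eI eI' /piece_time /= !in_itv /=.
  move=> /andP[y1 y2] /andP[y3 y4].
  suff jj' : j = j' by rewrite -ja -jb jj'.
  apply/val_inj; case: (ltngtP j j') => // lt_jj'; exfalso.
    by have := t_homo lt_jj'; lra.
  by have := t_homo lt_jj'; lra.
- move=> a l I /mem_pieces[j <- ->] y.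
  rewrite /piece_time /private_time /= index_job !in_itv /= => /andP[y1 ->].
  by rewrite (le_lt_trans (t_ge0 j) y1).
Qed.

(** Each job moves to equally many of the cheapest processors: lengths are kept, costs do not grow,
    and nested sets give nonincreasing cardinals. *)
Lemma synchronized_of_normal : exists S : schedule R J m,
  synchronized p S /\
  seq_value (w \o job) c x <= total_weighted_overlap w c S.
Proof.
have [tpos x01 tight xn0 nested] := normal_x.
exists S; split.
  split; first exact: feasible_S.
  exists k, job, procs, t; split => //.
  - split=> [j|j j' jj'].
      rewrite procs_le andbT card_gt0; apply/set0Pn.
      by have [i xi] := xn0 j; exists i; rewrite inE.
    apply/subset_leq_card/fintype.subsetP => i; rewrite !inE.
    by apply: contraNN => /eqP/(nested _ _ _ jj') ->.
  - by split=> [|j]; [rewrite /t big_pred0|exact: t_homo].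
  - by move=> a /index_None ai; rewrite /= ai.
  - by move=> j; rewrite /= index_job.
rewrite /total_weighted_overlap exchange_big /=.
under eq_bigr => a _ do
  under eq_bigr => i _ do rewrite (overlapE a i feasible_S).
rewrite (sum_over_injection job_inj) /seq_value.
  apply: ler_sum => j _; under [leRHS]eq_bigr do rewrite sum_pieces.
  under [leLHS]eq_bigr do rewrite xE.
  have if_mulr (b : bool) (a y : R) :
    (if b then a else 0) * y = if b then a * y else 0.
    by case: b; rewrite ?mul0r.
  under [leLHS]eq_bigr do rewrite if_mulr.
  under [leRHS]eq_bigr do rewrite if_mulr.
  rewrite -!big_mkcond -!mulr_sumr ler_wpM2l // !sumrB sumr_const.
  by rewrite sum_first_ord // lerB // sum_first_le.
move=> a /index_None ai; rewrite big1 // => i _.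
by rewrite /= ai big_nil mul0r.
Qed.

End NormalSchedule.

(** The pieces of distinct jobs on one processor are disjoint and lie in (0, C), so additivity
    bounds their total measure by [C]. *)
Lemma sum_overlap_le (R : realType) (J L : finType) (m : nat) (p : J -> R)
    (S : schedule R J m) (job : L -> J) (P : pred L) (C : R) (i : 'I_m) :
  feasible p S -> injective job -> 0 <= C ->
  (forall l, P l -> completion S (job l) <= C) ->
  \sum_(l | P l) overlap S (job l) i <= C.
Proof.
move=> fS inj_job C0 PC.
have [l0 Pl0|nP] := pickP P; last by rewrite big_pred0.
pose mu := @lebesgue_measure R; pose F l := shared_time S (job l) i.
have mF l : measurable (F l).
  rewrite /F /shared_time bigcup_seq; apply: bigsetU_measurable => I _.
  exact: measurable_itv.
have FC l : P l -> (F l `<=` `]0%R, C[)%classic.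
  move=> Pl y [I sI yI]; have := feasible_in_private fS sI yI.
  rewrite /private_time /= !in_itv /= => /andP[-> yC].
  exact: lt_le_trans yC (PC _ Pl).
have muC : mu `]0%R, C[%classic = C%:E.
  rewrite /mu lebesgue_measure_itv /= lte_fin; case: ltP => [_|C0'].
    by rewrite oppr0 adde0.
  by congr EFin; apply/eqP; rewrite eq_le C0.
(* Finiteness matters because [fine] sends an infinite measure to 0. *)
have finF l : P l -> mu (F l) \is a fin_num.
  move=> Pl; rewrite ge0_fin_numE // (@le_lt_trans _ _ C%:E) ?ltry // -muC.
  apply: le_measure; [by apply: mem_set; exact: mF| |exact: FC].
  by apply: mem_set; exact: measurable_itv.
have ovE l : P l -> (overlap S (job l) i)%:E = mu (F l).
  move=> Pl; rewrite /overlap setIidl ?fineK //; first exact: finF.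
  by move=> y [I sI yI]; exact: (feasible_in_private fS sI yI).
rewrite -lee_fin -sumEFin (eq_bigr _ ovE) -big_filter.
set s := [seq _ <- _ | _].
have sP l : l \in s -> P l by rewrite mem_filter => /andP[].
rewrite (big_nth l0) big_mkord.
rewrite -(measure_semi_additive_ord_I mu (F := fun n => F (nth l0 s n))) => //.
- rewrite -muC; apply: le_measure; last 2 first.
  + by apply: mem_set; exact: measurable_itv.
  + rewrite -(bigcup_mkord _ (fun n => F (nth l0 s n))) => y [n /= ns].
    by apply: FC; apply: sP; exact: mem_nth.
  + by apply: mem_set; apply: bigsetU_measurable => n _; exact: mF.
- by move=> n _; exact: mF.
- move=> n n' /= ns ns' ne.
  have := feasible_distinct_jobs fS (i := i) Logic.I Logic.I ne => /inj_job/eqP.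
  by rewrite nth_uniq ?filter_uniq ?index_enum_uniq // => /eqP.
- by apply: bigsetU_measurable => n _; exact: mF.
Qed.

Lemma exists_seq_of_feasible (R : realType) (J : finType) (m : nat)
    (p w : J -> R) (c : 'I_m -> R) (S : schedule R J m) :
  feasible p S ->
  exists (job : 'I_#|J| -> J) tau x, [/\ injective job,
    seq_feasible (p \o job) tau x &
    seq_value (w \o job) c x = total_weighted_overlap w c S].
Proof.
move=> fS; pose r := relpre (completion S) <=%R.
(* In the order of completion times, all jobs up to [l] complete no later than [l], which bounds the
   prefix loads as [rearrange] requires. *)
pose s := sort r (enum J).
have ss : size s = #|J| by rewrite size_sort -cardE.
have us : uniq s by rewrite sort_uniq enum_uniq.
have s_sorted : sorted r s by apply: sort_sorted => a b; exact: le_total.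
(* The default is never reached; [enum_val l] serves because [J] may be empty. *)
pose job (l : 'I_#|J|) := nth (enum_val l) s l.
have jobE (l l' : 'I_#|J|) : job l = nth (enum_val l') s l.
  by apply: set_nth_default; rewrite ss.
have inj_job : injective job.
  move=> l l'; rewrite (jobE l l') /job => /eqP.
  by rewrite nth_uniq ?ss // => /eqP/val_inj.
have job_homo (l l' : 'I_#|J|) : (l <= l')%N ->
    completion S (job l) <= completion S (job l').
  move=> ll'; rewrite (jobE l l').
  have r_trans : transitive r by move=> a b d; exact: le_trans.
  have r_refl : reflexive r by move=> a; exact: lexx.
  by apply: (sorted_leq_nth r_trans r_refl _ s_sorted); rewrite ?inE ?ss.
have ov0 a i : 0 <= overlap S a i by exact: fine_ge0.
have D0 (l : 'I_#|J|) : 0 <= completion S (job l).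
  exact: feasible_completion_ge0 fS _.
have [| |tau [x [xt t0 row col ends]]] :=
    @rearrange _ _ _ (fun l i => overlap S (job l) i) _ _ D0 job_homo.
- by move=> l i; exact: ov0.
- move=> l i; apply: (sum_overlap_le (p := p)) => // l'; exact: job_homo.
exists job, tau, x; split => //.
  split=> // l; have [el _] := ends l.
  rewrite /= -(feasible_processing fS (job l)) row; apply: lerD => //.
  by apply: ler_sum => i _; rewrite (overlapE _ _ fS).
rewrite seq_valueE.
under eq_bigr do rewrite row.
under [X in _ - X]eq_bigr do rewrite col.
rewrite -(seq_valueE (w \o job) c (fun l i => overlap S (job l) i)).
rewrite /total_weighted_overlap exchange_big /= /seq_value.
rewrite (sum_over_injection inj_job) // => a na.
have [g _ gK] : bijective job by apply: inj_card_bij => //; rewrite card_ord.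
by case: (na (g a)).
Qed.

(** * Optimization over the orders of the jobs *)

Theorem theorem1 (R : realType) (J : finType) (m : nat)
    (p w : J -> R) (c : 'I_m -> R)
    (m_ge1 : (1 <= m)%N)
    (p_ge0 : forall j, 0 <= p j)
    (w_ge0 : forall j, 0 <= w j)
    (c_sorted : forall i i' : 'I_m, (i <= i')%N -> c i <= c i') :
  exists S : schedule R J m, optimal p w c S /\ synchronized p S.
Proof.
(* Finite functions encode the orders of the jobs, so a best order exists once each order has an
   optimal solution. *)
pose sol (job : {ffun 'I_#|J| -> J}) (s : _ * _) :=
  seq_feasible (p \o job) s.1 s.2 /\
  forall tau x, seq_feasible (p \o job) tau x ->
    seq_value (w \o job) c x <= seq_value (w \o job) c s.2.
have [best bestP] : {best & forall job, sol job (best job)}.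
  apply: choice => job.
  have [|tau [x [fx lexmax _]]] := seq_lexmax (w \o job) c (q := p \o job).
    by move=> j; exact: p_ge0.
  by exists (tau, x); split => // tau' x' /lexmax[/ltW|[->]].
pose val (job : {ffun 'I_#|J| -> J}) := seq_value (w \o job) c (best job).2.
pose job0 : {ffun 'I_#|J| -> J} := [ffun l => enum_val l].
have inj0 : injectiveb job0.
  by apply/injectiveP => l l'; rewrite !ffunE => /enum_val_inj.
pose job1 := [arg max_(job > job0 | injectiveb job) val job]%O.
have [/injectiveP inj1 max1] :
    injectiveb job1 /\ forall job : {ffun 'I_#|J| -> J},
      injectiveb job -> val job <= val job1.
  by rewrite /job1; case: arg_maxP.
have [f1 _] := bestP job1.
have [k [job [tau [x [inj_job normal_x le_val]]]]] :=
  exists_normal w c p_ge0 inj1 f1.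
have [S [syncS leS]] :=
  synchronized_of_normal w p_ge0 c_sorted inj_job normal_x.
exists S; split => //; split; first by case: syncS.
(* A feasible schedule is bounded by the optimum for its own order, hence by that for the best order
   [job1]. *)
move=> S' /(exists_seq_of_feasible w c)[job' [tau' [x' [inj' f' <-]]]].
apply: le_trans leS; apply: le_trans le_val.
pose job2 : {ffun 'I_#|J| -> J} := [ffun l => job' l].
have e2 (q : J -> R) : q \o job2 = q \o job'.
  by apply/funext => l; rewrite /= ffunE.
have inj2 : injectiveb job2.
  by apply/injectiveP => l l'; rewrite !ffunE => /inj'.
apply: le_trans (max1 _ inj2); rewrite /val -(e2 w).
by have [_] := bestP job2; rewrite e2 => /(_ _ _ f').
Qed.
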